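(* Let $\Gamma$ be a finite simplicial graph with vertex set $V=\{v_1,\dots,v_n\}$, let $A_\Gamma$ be the associated right-angled Artin group, and let $C_\Gamma(\iota)$ be the centraliser in $\mathrm{Aut}(A_\Gamma)$ of the automorphism $\iota$ that inverts each $v\in V$. There is an exact sequence $$1\longrightarrow \mathrm{P\Pi A}_\Gamma\longrightarrow C_\Gamma(\iota)\longrightarrow \mathrm{GL}(n,\mathbb{Z}/2),$$ where the first map is inclusion and the last map is the restriction to $C_\Gamma(\iota)$ of the canonical map $\Phi_2:\mathrm{Aut}(A_\Gamma)\to\mathrm{GL}(n,\mathbb{Z}/2)$ (so $\mathrm{P\Pi A}_\Gamma$ is the kernel of this restriction, and in particular a group). Moreover, the image of $C_\Gamma(\iota)$ in $\mathrm{GL}(n,\mathbb{Z}/2)$ is generated by the images of all diagram automorphisms and adjacent dominated transvections in $\mathrm{Aut}(A_\Gamma)$.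
   Context: $A_\Gamma$ is the group with generating set $V$ and relations $[v_i,v_j]=1$ whenever $v_i,v_j$ are joined by an edge of $\Gamma$. $\Phi_2$ is induced by the mod 2 abelianisation map $A_\Gamma\to(\mathbb{Z}/2)^n$. $\mathrm{P\Pi A}_\Gamma$ (pure palindromic automorphisms) is the set of $\alpha\in\mathrm{Aut}(A_\Gamma)$ such that for each $v\in V$ the element $\alpha(v)$ may be expressed as a palindrome (a word on $V^{\pm1}$ identical to its reverse) whose middle letter is $v$ or $v^{-1}$. A diagram automorphism is an automorphism of $A_\Gamma$ induced by a graph automorphism of $\Gamma$. For a vertex $u$, $\mathrm{lk}(u)$ is the set of vertices adjacent to $u$, and $\mathrm{st}(u)=\mathrm{lk}(u)\cup\{u\}$; write $u\le v$ if $\mathrm{lk}(u)\subset\mathrm{st}(v)$. For $i\ne j$ with $v_i\le v_j$, the dominated transvection $\tau_{ij}$ is the automorphism mapping $v_i$ to $v_iv_j$ and fixing all other vertices; it is adjacent if $[v_i,v_j]=1$. *)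

(* Defs.v *)
From HB Require Import structures.
From mathcomp Require Import fingroup perm all_boot all_algebra.
From mathcomp Require Import boolp classical_sets.

Set Implicit Arguments.
Unset Strict Implicit.
Unset Printing Implicit Defensive.

Local Open Scope quotient_scope.
Local Open Scope classical_set_scope.
Local Open Scope group_scope.

Section Groups.
Variable G : groupType.

Definition is_subgroup (H : set G) : Prop :=
  H 1 /\ (forall x y, H x -> H y -> H (x * y^-1)).

Definition subgroup_generated_by (S : set G) : set G := smallest is_subgroup S.

Definition centraliser_of (x : G) : set G := [set y | commute y x].

Definition hom_kernel (L : groupType) (f : G -> L) : set G := [set x | f x = 1].

Lemma centraliser_of_subgroup x : is_subgroup (centraliser_of x).
Proof.
split=> [|y z Cy Cz]; first by rewrite /centraliser_of/= /commute mul1g mulg1.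
rewrite /centraliser_of/= /commute -mulgA.
have -> : z^-1 * x = x * z^-1.
  by apply: (mulgI z); rewrite mulKVg mulgA Cz mulgK.
by rewrite !mulgA Cy.
Qed.

(** Aut(G), with composition as product.
    The inverse is a field of the structure, but it is determined by the
    underlying function, see [gaut_eq]. *)
Record gaut := Gaut {
  gaut_fun :> G -> G;
  gaut_inv : G -> G;
  gautM : {morph gaut_fun : x y / x * y};
  gautK : cancel gaut_fun gaut_inv;
  gautVK : cancel gaut_inv gaut_fun }.

Lemma gaut_eq (f g : gaut) : f =1 g -> f = g.
Proof.
case: f g => f f' fM fK fVK [g g' gM gK gVK] /= fg.
have Efg : f = g by apply/funext.
subst g; have Efg' : f' = g'.
  by apply/funext => x; rewrite -{1}[x]gVK fK.
subst g'; congr Gaut; exact: Prop_irrelevance.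
Qed.

Lemma gaut1_proof : {morph (@id G) : x y / x * y}. Proof. by []. Qed.
Definition gaut_one := @Gaut id id gaut1_proof (fun=> erefl) (fun=> erefl).

Lemma gautM_proof (f g : gaut) : {morph f \o g : x y / x * y}.
Proof. by move=> x y /=; rewrite !gautM. Qed.
Definition gaut_mul (f g : gaut) : gaut :=
  @Gaut (f \o g) (gaut_inv g \o gaut_inv f) (gautM_proof f g)
    (can_comp (@gautK f) (@gautK g)) (can_comp (@gautVK g) (@gautVK f)).

Lemma gautV_proof (f : gaut) : {morph gaut_inv f : x y / x * y}.
Proof.
by move=> x y; apply: (can_inj (@gautK f)); rewrite gautM !gautVK.
Qed.
Definition gaut_opp (f : gaut) : gaut :=
  @Gaut (gaut_inv f) f (gautV_proof f) (@gautVK f) (@gautK f).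

Lemma gaut_mulA : associative gaut_mul.
Proof. by move=> f g h; apply: gaut_eq. Qed.
Lemma gaut_mul1 : left_id gaut_one gaut_mul.
Proof. by move=> f; apply: gaut_eq. Qed.
Lemma gaut_mulr1 : right_id gaut_one gaut_mul.
Proof. by move=> f; apply: gaut_eq. Qed.
Lemma gaut_mulV : left_inverse gaut_one gaut_opp gaut_mul.
Proof. by move=> f; apply: gaut_eq => x /=; rewrite gautK. Qed.
Lemma gaut_mulrV : right_inverse gaut_one gaut_opp gaut_mul.
Proof. by move=> f; apply: gaut_eq => x /=; rewrite gautVK. Qed.

HB.instance Definition _ := gen_eqMixin gaut.
HB.instance Definition _ := gen_choiceMixin gaut.
HB.instance Definition _ := isGroup.Build gaut
  gaut_mulA gaut_mul1 gaut_mulr1 gaut_mulV gaut_mulrV.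

Lemma gaut1E x : (1 : gaut) x = x. Proof. by []. Qed.
Lemma gautME (f g : gaut) x : (f * g) x = f (g x). Proof. by []. Qed.

End Groups.

(** MathComp's ['GL_n[R]] consists of matrices of size [n.-1.+1], so it is
    not used here: [n = 0] is allowed. *)
Section GL2.
Local Open Scope ring_scope.
Variable n : nat.

Record GL2 := MkGL2 { GL2_val :> 'M['F_2]_n; _ : GL2_val \in unitmx }.
HB.instance Definition _ := [isSub for GL2_val].
HB.instance Definition _ := [Finite of GL2 by <:].

Lemma GL2_unit (A : GL2) : (A : 'M_n) \in unitmx. Proof. exact: valP A. Qed.
Lemma GL2_one_proof : (1%:M : 'M['F_2]_n) \in unitmx.
Proof. exact: unitmx1. Qed.
Definition GL2_one := MkGL2 GL2_one_proof.
Lemma GL2_mul_proof (A B : GL2) : A *m B \in unitmx.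
Proof. by rewrite unitmx_mul !GL2_unit. Qed.
Definition GL2_mul A B := MkGL2 (GL2_mul_proof A B).
Lemma GL2_inv_proof (A : GL2) : invmx A \in unitmx.
Proof. by rewrite unitmx_inv GL2_unit. Qed.
Definition GL2_inv A := MkGL2 (GL2_inv_proof A).

Lemma GL2_mulA : associative GL2_mul.
Proof. by move=> A B C; apply: val_inj; apply: mulmxA. Qed.
Lemma GL2_mul1 : left_id GL2_one GL2_mul.
Proof. by move=> A; apply: val_inj; apply: mul1mx. Qed.
Lemma GL2_mulV : left_inverse GL2_one GL2_inv GL2_mul.
Proof. by move=> A; apply: val_inj; apply: mulVmx (GL2_unit A). Qed.

HB.instance Definition _ :=
  Finite_isGroup.Build GL2 GL2_mulA GL2_mul1 GL2_mulV.

End GL2.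

(** A letter [(i, b)] stands for the vertex [i] if [b] is false, and for its
    formal inverse if [b] is true. *)
Definition letter (n : nat) := ('I_n * bool)%type.
Definition word (n : nat) := seq (letter n).
Definition inv_letter n (x : letter n) : letter n := (x.1, ~~ x.2).
Definition inv_word n (w : word n) : word n := rev (map (@inv_letter n) w).

Section Raag.
Variables (n : nat) (e : rel 'I_n).

Inductive raag_eq : word n -> word n -> Prop :=
| raag_refl w : raag_eq w w
| raag_sym w1 w2 : raag_eq w1 w2 -> raag_eq w2 w1
| raag_trans w1 w2 w3 : raag_eq w1 w2 -> raag_eq w2 w3 -> raag_eq w1 w3
| raag_cancel u w x : raag_eq (u ++ [:: x; inv_letter x] ++ w) (u ++ w)
| raag_comm u w i j : e i j ->
    raag_eq (u ++ [:: (i, false); (j, false)] ++ w)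
            (u ++ [:: (j, false); (i, false)] ++ w).

Definition raag_eqb : rel (word n) := fun w1 w2 => `[< raag_eq w1 w2 >].

Lemma raag_eqb_refl : reflexive raag_eqb.
Proof. by move=> w; apply/asboolP; apply: raag_refl. Qed.
Lemma raag_eqb_sym : symmetric raag_eqb.
Proof. by move=> u w; apply/asboolP/asboolP; apply: raag_sym. Qed.
Lemma raag_eqb_trans : transitive raag_eqb.
Proof.
by move=> v u w /asboolP uv /asboolP vw; apply/asboolP; apply: raag_trans vw.
Qed.

Canonical raag_equiv := EquivRel raag_eqb
  raag_eqb_refl raag_eqb_sym raag_eqb_trans.

Definition raag := {eq_quot raag_equiv}.
HB.instance Definition _ := Choice.on raag.
HB.instance Definition _ := EqQuotient.on raag.

Definition word_val (w : word n) : raag := \pi_raag w.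

Lemma word_valP u w : word_val u = word_val w <-> raag_eq u w.
Proof.
split=> [/eqmodP/asboolP // | uw].
by apply/eqmodP/asboolP.
Qed.

Lemma raagW (P : raag -> Prop) : (forall w, P (word_val w)) -> forall g, P g.
Proof. by move=> PW g; rewrite -[g]reprK; apply: PW. Qed.

Lemma word_val_repr w : raag_eq (repr (word_val w)) w.
Proof. by apply/word_valP; rewrite /word_val reprK. Qed.

Lemma raag_eq_cat u u' w w' :
  raag_eq u u' -> raag_eq w w' -> raag_eq (u ++ w) (u' ++ w').
Proof.
move=> uu' ww'; apply: (@raag_trans _ (u' ++ w)).
  elim: uu' => {u u'} => [u|u v _|u v t _ uv _ vt|u t x|u t i j eij].
  - exact: raag_refl.
  - exact: raag_sym.
  - exact: raag_trans vt.
  - by rewrite -!catA; apply: raag_cancel.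
  - by rewrite -!catA; apply: raag_comm.
elim: ww' => {w w'} => [w|w v _|w v t _ wv _ vt|w t x|w t i j eij].
- exact: raag_refl.
- exact: raag_sym.
- exact: raag_trans vt.
- by rewrite !(catA u'); apply: raag_cancel.
- by rewrite !(catA u'); apply: raag_comm.
Qed.

Lemma inv_letterK : involutive (@inv_letter n).
Proof. by case=> i b; rewrite /inv_letter /= negbK. Qed.

Lemma raag_eq_catV w : raag_eq (w ++ inv_word w) [::].
Proof.
elim: w => [|x w IHw]; first exact: raag_refl.
rewrite /inv_word map_cons rev_cons -cats1 cat_cons catA.
apply: (@raag_trans _ ([:: x] ++ [::] ++ [:: inv_letter x])).
  apply: (@raag_eq_cat [:: x]); first exact: raag_refl.
  by apply: raag_eq_cat; [exact: IHw | exact: raag_refl].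
exact: (@raag_cancel [::] [::] x).
Qed.

Lemma inv_wordK : involutive (@inv_word n).
Proof. by move=> w; rewrite /inv_word map_rev revK (mapK inv_letterK). Qed.

Lemma raag_eq_Vcat w : raag_eq (inv_word w ++ w) [::].
Proof. by rewrite -{2}[w]inv_wordK; apply: raag_eq_catV. Qed.

Lemma raag_eq_inv u w : raag_eq u w -> raag_eq (inv_word u) (inv_word w).
Proof.
move=> uw; rewrite -[inv_word u]cats0.
apply: (@raag_trans _ (inv_word u ++ (w ++ inv_word w))).
  by apply: raag_eq_cat; [exact: raag_refl | exact/raag_sym/raag_eq_catV].
rewrite catA -[X in raag_eq _ X]cat0s; apply: raag_eq_cat (raag_refl _).
apply: raag_trans (raag_eq_Vcat u).
by apply: raag_eq_cat; [exact: raag_refl | exact: raag_sym].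
Qed.

Definition raag_one : raag := word_val [::].
Definition raag_mul (g h : raag) : raag := word_val (repr g ++ repr h).
Definition raag_inv (g : raag) : raag := word_val (inv_word (repr g)).

Lemma raag_mulE u w : raag_mul (word_val u) (word_val w) = word_val (u ++ w).
Proof. by apply/word_valP; apply: raag_eq_cat; apply: word_val_repr. Qed.
Lemma raag_invE w : raag_inv (word_val w) = word_val (inv_word w).
Proof. by apply/word_valP; apply/raag_eq_inv/word_val_repr. Qed.

Lemma raag_mulA : associative raag_mul.
Proof.
elim/raagW=> u; elim/raagW=> v; elim/raagW=> w.
by rewrite !raag_mulE catA.
Qed.
Lemma raag_mul1 : left_id raag_one raag_mul.
Proof. by elim/raagW=> w; rewrite raag_mulE. Qed.
Lemma raag_mulr1 : right_id raag_one raag_mul.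
Proof. by elim/raagW=> w; rewrite raag_mulE cats0. Qed.
Lemma raag_mulV : left_inverse raag_one raag_inv raag_mul.
Proof.
elim/raagW=> w; rewrite raag_invE raag_mulE; apply/word_valP.
exact: raag_eq_Vcat.
Qed.
Lemma raag_mulrV : right_inverse raag_one raag_inv raag_mul.
Proof.
elim/raagW=> w; rewrite raag_invE raag_mulE; apply/word_valP.
exact: raag_eq_catV.
Qed.

HB.instance Definition _ := isGroup.Build raag
  raag_mulA raag_mul1 raag_mulr1 raag_mulV raag_mulrV.

Definition gen (i : 'I_n) : raag := word_val [:: (i, false)].

Lemma word_val0 : word_val [::] = 1. Proof. by []. Qed.
Lemma word_val_cat u w : word_val (u ++ w) = word_val u * word_val w.
Proof. by rewrite -raag_mulE. Qed.
Lemma word_val_inv w : word_val (inv_word w) = (word_val w)^-1.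
Proof. by rewrite -raag_invE. Qed.
Lemma word_val_letter i b :
  word_val [:: (i, b)] = if b then (gen i)^-1 else gen i.
Proof. by case: b => //; rewrite -word_val_inv. Qed.
Lemma gen_comm i j : e i j -> [~ gen i, gen j] = 1.
Proof.
move=> eij; have C : gen i * gen j = gen j * gen i.
  rewrite -!word_val_cat; apply/word_valP.
  exact: (@raag_comm [::] [::] i j eij).
by rewrite /commg /conjg C mulKg mulVg.
Qed.

End Raag.

Section RaagAut.
Variables (n : nat) (e : rel 'I_n).
Local Notation A := (raag e).
Local Notation v := (gen e).

Definition flip_word (w : word n) : word n := map (@inv_letter n) w.

Lemma flip_wordE u w : raag_eq e u w -> raag_eq e (flip_word u) (flip_word w).
Proof.
elim=> {u w} => [u|u w _|u w t _ uw _ wt|u t x|u t i j eij].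
- exact: raag_refl.
- exact: raag_sym.
- exact: raag_trans wt.
- by rewrite /flip_word !map_cat /=; apply: raag_cancel.
- rewrite /flip_word !map_cat /=.
  apply: raag_eq_cat (raag_refl _ _) _.
  apply: (@raag_eq_cat _ _ [:: _; _] [:: _; _]) (raag_refl _ _).
  apply: (@raag_eq_inv _ e [:: (j, false); (i, false)]
                           [:: (i, false); (j, false)]).
  exact/raag_sym/(@raag_comm _ _ [::] [::]).
Qed.

Definition raag_iota_fun (g : A) : A := word_val e (flip_word (repr g)).

Lemma raag_iota_funE w : raag_iota_fun (word_val e w) = word_val e (flip_word w).
Proof. by apply/word_valP; apply/flip_wordE/word_val_repr. Qed.
Lemma raag_iota_funM : {morph raag_iota_fun : x y / x * y}.
Proof.
elim/raagW=> u; elim/raagW=> w.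
by rewrite -word_val_cat !raag_iota_funE /flip_word map_cat word_val_cat.
Qed.
Lemma raag_iota_funK : involutive raag_iota_fun.
Proof.
by elim/raagW=> w; rewrite !raag_iota_funE /flip_word (mapK (@inv_letterK n)).
Qed.

Definition raag_iota : gaut A := Gaut raag_iota_funM raag_iota_funK raag_iota_funK.

Lemma raag_iota_gen i : raag_iota (v i) = (v i)^-1.
Proof. by rewrite /= raag_iota_funE -word_val_inv. Qed.

Definition palindrome (w : word n) : Prop := rev w = w.

Definition middle_letter (w : word n) (x : letter n) : Prop :=
  exists s t : word n, size s = size t /\ w = s ++ x :: t.

(** The palindromic word [w] is not required to be reduced. *)
Definition PPiA : set (gaut A) :=
  [set f | forall i, exists w : word n, [/\ palindrome w,
     (exists b, middle_letter w (i, b)) & word_val e w = f (v i)]].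

Definition lk (u : 'I_n) : {set 'I_n} := [set w | e u w]%SET.
Definition st (u : 'I_n) : {set 'I_n} := (lk u :|: [set u])%SET.
Definition vle (u w : 'I_n) : bool := lk u \subset st w.

Definition diagram_aut : set (gaut A) :=
  [set f | exists s : {perm 'I_n},
     (forall i j, e (s i) (s j) = e i j) /\ (forall i, f (v i) = v (s i))].

Definition is_transvection (i j : 'I_n) (f : gaut A) : Prop :=
  f (v i) = v i * v j /\ (forall k, k != i -> f (v k) = v k).

Definition adjacent_dominated_transvection : set (gaut A) :=
  [set f | exists i j, [/\ i != j, vle i j, [~ v i, v j] = 1
                         & is_transvection i j f]].

(** A vertex and its inverse have the same image in (Z/2)^n, so it suffices to
    count the letters with a given vertex. *)
Definition word_ab2 (w : word n) : 'cV['F_2]_n :=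
  (\col_i (count (fun x => x.1 == i) w)%:R)%R.
Definition ab2 (g : A) : 'cV['F_2]_n := word_ab2 (repr g).

Lemma word_ab2_cat u w : word_ab2 (u ++ w) = (word_ab2 u + word_ab2 w)%R.
Proof. by apply/colP=> i; rewrite !mxE count_cat GRing.natrD. Qed.

Lemma F2_addrr (x : 'F_2) : (x + x = 0)%R.
Proof. by case: x => [[|[|?]] ?] //; apply: val_inj. Qed.

Lemma word_ab2_eq u w : raag_eq e u w -> word_ab2 u = word_ab2 w.
Proof.
elim=> {u w} // => [u w t _ -> _ //|u t x|u t i j _].
- rewrite !word_ab2_cat (_ : word_ab2 [:: x; _] = 0%R) ?GRing.add0r //.
  apply/colP=> i; rewrite !mxE /= addn0 GRing.natrD; exact: F2_addrr.
- rewrite !word_ab2_cat; congr (_ + (_ + _))%R.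
  by apply/colP=> k; rewrite !mxE /= addnCA.
Qed.

Lemma ab2E w : ab2 (word_val e w) = word_ab2 w.
Proof. exact/word_ab2_eq/word_val_repr. Qed.
Lemma ab2M g h : ab2 (g * h) = (ab2 g + ab2 h)%R.
Proof.
by move: g h; elim/raagW=> u; elim/raagW=> w;
   rewrite -word_val_cat !ab2E word_ab2_cat.
Qed.
Lemma ab2_gen i : ab2 (v i) = (delta_mx i ord0)%R.
Proof.
by rewrite ab2E; apply/colP=> k; rewrite !mxE /= addn0 eqxx andbT eq_sym.
Qed.

(** The j-th column is the image of [f (v j)], so that composition of
    automorphisms corresponds to the matrix product. *)
Definition Phi2_mx (f : gaut A) : 'M['F_2]_n :=
  (\matrix_(i, j) ab2 (f (v j)) i ord0)%R.

Lemma ab2_1 : ab2 1 = 0%R.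
Proof. by rewrite -word_val0 ab2E; apply/colP=> i; rewrite !mxE. Qed.
Lemma ab2V g : ab2 g^-1 = ab2 g.
Proof.
apply: (GRing.addIr (ab2 g)); rewrite -ab2M mulVg ab2_1.
by apply/colP=> i; rewrite !mxE F2_addrr.
Qed.

Lemma gaut1 (f : gaut A) : f 1 = 1.
Proof. by apply: (mulgI (f 1)); rewrite -gautM !mulg1. Qed.
Lemma gautV (f : gaut A) g : f g^-1 = (f g)^-1.
Proof. by apply: (mulgI (f g)); rewrite -gautM !mulgV gaut1. Qed.

(** [Phi2_mx f] is the matrix of the map induced by [f] on (Z/2)^n. *)
Lemma Phi2_mxP (f : gaut A) g : ab2 (f g) = (Phi2_mx f *m ab2 g)%R.
Proof.
elim/raagW: g => w; elim: w => [|[i b] w IHw].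
  by rewrite word_val0 gaut1 ab2_1 mulmx0.
rewrite -cat1s word_val_cat gautM !ab2M mulmxDr IHw; congr (_ + _)%R.
have E : ab2 (f (v i)) = (Phi2_mx f *m ab2 (v i))%R.
  by rewrite ab2_gen -colE; apply/colP=> k; rewrite !mxE.
by rewrite word_val_letter; case: b => //; rewrite gautV !ab2V.
Qed.

Lemma Phi2_mx1 : Phi2_mx 1 = (1%:M)%R.
Proof. by apply/matrixP=> i j; rewrite mxE gaut1E ab2_gen !mxE eqxx andbT. Qed.
Lemma Phi2_mxM f g : Phi2_mx (f * g) = (Phi2_mx f *m Phi2_mx g)%R.
Proof.
apply/matrixP=> i j; rewrite [LHS]mxE gautME Phi2_mxP [LHS]mxE [RHS]mxE.
by apply: eq_bigr => k _; rewrite [Phi2_mx g k j]mxE.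
Qed.
Lemma Phi2_unitmx f : Phi2_mx f \in unitmx.
Proof.
have : (Phi2_mx f *m Phi2_mx (f^-1)%g = 1%:M)%R by rewrite -Phi2_mxM mulgV Phi2_mx1.
by case/mulmx1_unit.
Qed.

Definition Phi2 (f : gaut A) : GL2 n := MkGL2 (Phi2_unitmx f).

Lemma Phi2_monoid_morphism : monoid_morphism Phi2.
Proof.
by split=> [|f g]; apply: val_inj; [exact: Phi2_mx1 | exact: Phi2_mxM].
Qed.
HB.instance Definition _ :=
  isUMagmaMorphism.Build (gaut A) (GL2 n) Phi2 Phi2_monoid_morphism.

End RaagAut.

Arguments raag_iota {n} e.
Arguments PPiA {n} e.
Arguments diagram_aut {n} e.
Arguments adjacent_dominated_transvection {n} e.

(* Main.v *)
Require Import Defs.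
From mathcomp Require Import fingroup perm all_boot all_algebra ring.
From mathcomp Require Import boolp classical_sets.

(** Reading a word backwards induces on the group the map
    [g |-> iota g^-1], so [f] commutes with [iota] if and only if each
    [f (v i)] equals its own reverse.

    An element equal to its reverse has the form [u c (rev u)], where the
    letters of [c] have distinct, pairwise adjacent vertices
    ([symmetric_split]). The proof takes a shortest word and moves letters to
    its two ends, using an action of the group on pilings (stacks of signs and
    blanks) to decide which letters can be moved. Modulo 2 the outer parts
    cancel. If [f] acts trivially on (Z/2)^n, the factor [c] of [f (v i)] must
    then be a single letter, [v i] or its inverse, and [u c (rev u)] is the
    palindrome sought. So the pure palindromic automorphisms are the kernel
    ([PPiA_kernel]), hence a subgroup.

    For the image, let [M] be the matrix of [f] in the centraliser, and let
    [S i] be the support of its column [i]. Counting modulo 2 the pairs of a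
    letter [a] followed later by a letter [b], for non-adjacent distinct [a]
    and [b], is well defined on the group. It shows that [S i] is a clique and
    that, for [j] in the star of [i], the set [S j] lies in the star of every
    [a] in [S i] ([support_in_star]). As [M] is invertible, some permutation
    [s] satisfies [s j \in S j] for all [j], and the inclusion above says that
    [s] preserves adjacency: it is a diagram automorphism. After division by
    [s], a nonzero entry at [(a, i)] forces the star of [i] into the star of
    [a]. Such a matrix is a product of elementary ones of the same shape, by
    Gaussian elimination that processes the columns with the fewest stars above
    theirs first ([incidence_generated]), and the elementary ones are the
    images of the adjacent dominated transvections. *)

Set Implicit Arguments.
Unset Strict Implicit.
Unset Printing Implicit Defensive.

Local Open Scope group_scope.

(** * Homomorphisms defined on generators, and reversal of words *)

Section Homomorphisms.
Variables (n : nat) (e : rel 'I_n).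
Local Notation A := (raag e).
Local Notation v := (gen e).
Local Notation val := (word_val e).

Lemma word_val_cons x w : val (x :: w) = val [:: x] * val w.
Proof. by rewrite -word_val_cat. Qed.

Lemma morph_one (G L : groupType) (f : G -> L) :
  {morph f : x y / x * y} -> f 1 = 1.
Proof. by move=> fM; apply: (mulgI (f 1)); rewrite -fM !mulg1. Qed.

Lemma morph_inv (G L : groupType) (f : G -> L) :
  {morph f : x y / x * y} -> forall x, f x^-1 = (f x)^-1.
Proof.
by move=> fM x; apply: (mulgI (f x)); rewrite -fM !mulgV (morph_one fM).
Qed.

Lemma raag_morph_ext (L : groupType) (f h : A -> L) :
    {morph f : x y / x * y} -> {morph h : x y / x * y} ->
  (forall i, f (v i) = h (v i)) -> f =1 h.
Proof.
move=> fM hM fh; elim/raagW; elim=> [|[i b] w IHw].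
  by rewrite word_val0 !morph_one.
rewrite word_val_cons fM hM IHw word_val_letter.
by case: b; rewrite ?(morph_inv fM) ?(morph_inv hM) fh.
Qed.

Lemma gaut_ext (f h : gaut A) : (forall i, f (v i) = h (v i)) -> f = h.
Proof. by move=> fh; apply/gaut_eq/raag_morph_ext => //; apply: gautM. Qed.

(** An automorphism commutes with the inversion as soon as the two composites
    agree on the generators, where the inversion is [x |-> x^-1]. *)
Lemma centraliser_iotaP (f : gaut A) :
  centraliser_of (raag_iota e) f <->
  forall i, raag_iota e (f (v i)) = (f (v i))^-1.
Proof.
split=> [Cf i | Cf].
  by rewrite -gautME -[_ * f]Cf gautME raag_iota_gen gautV.
by apply: gaut_ext => i; rewrite !gautME raag_iota_gen gautV Cf.
Qed.

(** Reading a word backwards is the anti-automorphism [g |-> iota g^-1]; hence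
    reversal is well defined on the group, and an image [f (v i)] under an
    automorphism commuting with [iota] equals its own reverse. *)
Lemma word_val_rev w : val (rev w) = (raag_iota e (val w))^-1.
Proof.
by rewrite /= raag_iota_funE -word_val_inv /inv_word (mapK (@inv_letterK n)).
Qed.

Lemma iota_inv_rev w :
  raag_iota e (val w) = (val w)^-1 <-> val (rev w) = val w.
Proof.
by rewrite word_val_rev; split=> [-> | {2}<-]; rewrite ?invgK.
Qed.

Lemma word_val_rev_eq u w : val u = val w -> val (rev u) = val (rev w).
Proof. by rewrite !word_val_rev => ->. Qed.

Section Lift.
Variables (L : groupType) (phi : 'I_n -> L).

Definition letter_image (x : letter n) : L :=
  if x.2 then (phi x.1)^-1 else phi x.1.
Definition word_image (w : word n) : L :=
  foldr (fun x g => letter_image x * g) 1 w.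

Lemma word_image_cat u w : word_image (u ++ w) = word_image u * word_image w.
Proof. by elim: u => [|x u IHu] /=; rewrite ?mul1g // IHu mulgA. Qed.

Hypothesis phiC : forall i j, e i j -> commute (phi i) (phi j).

Lemma word_image_eq u w : raag_eq e u w -> word_image u = word_image w.
Proof.
elim=> {u w} // [u w t _ -> _ //|u w [i b]|u w i j eij].
- rewrite !word_image_cat /= mulg1; congr (_ * _).
  by case: b; rewrite /letter_image /= ?mulVg ?mulgV mul1g.
- by rewrite !word_image_cat /= !mulg1 /letter_image /= phiC.
Qed.

Definition raag_lift (g : A) : L := word_image (repr g).

Lemma raag_liftE w : raag_lift (val w) = word_image w.
Proof. exact/word_image_eq/word_val_repr. Qed.

Lemma raag_liftM : {morph raag_lift : x y / x * y}.
Proof.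
elim/raagW=> u; elim/raagW=> w.
by rewrite -word_val_cat !raag_liftE word_image_cat.
Qed.

Lemma raag_lift_gen i : raag_lift (v i) = phi i.
Proof. by rewrite raag_liftE /= mulg1. Qed.

End Lift.

(** Two maps on generators that respect the commutations and are mutually
    inverse there extend to mutually inverse endomorphisms. *)
Lemma raag_gaut (phi psi : 'I_n -> A)
    (phiC : forall i j, e i j -> commute (phi i) (phi j))
    (psiC : forall i j, e i j -> commute (psi i) (psi j)) :
    (forall i, raag_lift phi (psi i) = v i) ->
    (forall i, raag_lift psi (phi i) = v i) ->
  exists f : gaut A, forall i, f (v i) = phi i.
Proof.
move=> phipsi psiphi.
have phiM := raag_liftM phiC; have psiM := raag_liftM psiC.
have K1 : cancel (raag_lift phi) (raag_lift psi).
  apply: (@raag_morph_ext A (raag_lift psi \o raag_lift phi) id) => // [x y|i] /=.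
    by rewrite phiM psiM.
  by rewrite raag_lift_gen.
have K2 : cancel (raag_lift psi) (raag_lift phi).
  apply: (@raag_morph_ext A (raag_lift phi \o raag_lift psi) id) => // [x y|i] /=.
    by rewrite psiM phiM.
  by rewrite raag_lift_gen.
by exists (Gaut phiM K1 K2) => i /=; rewrite raag_lift_gen.
Qed.

Lemma gen_commute i j : e i j -> commute (v i) (v j).
Proof. by move=> eij; apply/commgP/eqP/gen_comm. Qed.

Lemma diagram_aut_exists (s : {perm 'I_n}) :
    (forall i j, e (s i) (s j) = e i j) ->
  exists f : gaut A, forall i, f (v i) = v (s i).
Proof.
move=> es.
have sC i j : e i j -> commute (v (s i)) (v (s j)).
  by rewrite -es; apply: gen_commute.
have sVC i j : e i j -> commute (v (s^-1 i)%g) (v (s^-1 j)%g).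
  by rewrite -{1}[i](permKV s) -{1}[j](permKV s) es; apply: gen_commute.
apply: (@raag_gaut (fun i => v (s i)) (fun i => v (s^-1 i)%g)) => // i.
  by rewrite raag_lift_gen ?permKV.
by rewrite raag_lift_gen ?permK.
Qed.

(** Domination makes the rule respect the commutations: a neighbour [b] of
    [i] lies in the star of [j], so [v b] commutes with both factors of
    [v i * v j]. *)
Lemma transvection_exists (i j : 'I_n) : irreflexive e -> symmetric e ->
  e i j -> vle e i j -> exists f : gaut A, is_transvection i j f.
Proof.
move=> e_irr e_sym eij ij.
have nij : j != i by apply: contraTneq eij => ->; rewrite e_irr.
pose phi c k := if k == i then v i * c else v k.
have phiC c : c = v j \/ c = (v j)^-1 ->
    forall a b, e a b -> commute (phi c a) (phi c b).
  move=> Dc.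
  have iC b : e i b -> commute (v i * c) (v b).
    move=> eib; apply/commute_sym/commuteM.
      exact/commute_sym/gen_commute.
    have jC : commute (v b) (v j).
      have := fintype.subsetP ij b; rewrite !inE => /(_ eib) /orP[ejb|/eqP->].
        exact/commute_sym/gen_commute.
      exact: commute_refl.
    by case: Dc => ->; [|apply: commuteV].
  move=> a b eab; rewrite /phi.
  case: eqP eab => [->|_]; case: eqP => [->|_] eab.
  - by rewrite e_irr in eab.
  - exact: iC.
  - by apply/commute_sym/iC; rewrite e_sym.
  - exact: gen_commute.
have C1 := phiC _ (or_introl erefl); have C2 := phiC _ (or_intror erefl).
have [k|k|f fE] := @raag_gaut (phi (v j)) (phi (v j)^-1) C1 C2.
- rewrite {2}/phi; case: eqP => [->|/eqP/negPf ki].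
    rewrite raag_liftM // (morph_inv (raag_liftM C1)) !raag_lift_gen //.
    by rewrite /phi eqxx (negPf nij) mulgK.
  by rewrite raag_lift_gen // /phi ki.
- rewrite {2}/phi; case: eqP => [->|/eqP/negPf ki].
    by rewrite raag_liftM // !raag_lift_gen // /phi eqxx (negPf nij) mulgKV.
  by rewrite raag_lift_gen // /phi ki.
exists f; split=> [|k /negPf ki]; first by rewrite fE /phi eqxx.
by rewrite fE /phi ki.
Qed.

End Homomorphisms.

(** * Pilings, reduced words and elements equal to their reverse *)

Section ReducedWords.
Variables (n : nat) (e : rel 'I_n).
Hypotheses (e_sym : symmetric e) (e_irr : irreflexive e).
Local Notation val := (word_val e).

(** A piling records a word up to commutations, as one stack for each vertex
    [k], with its head on top. A letter puts its sign on the stack of its own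
    vertex and a blank on the stack of each vertex that does not commute with
    it. So a sign on top of a stack marks a letter that commutation moves to
    the end of the word. *)
Definition piling := 'I_n -> seq (option bool).
Implicit Types (p : piling) (x y z : letter n) (s t u w : word n).

Definition push p x : piling := fun k =>
  if e x.1 k then p k else (if k == x.1 then Some x.2 else None) :: p k.
Definition pop p (i : 'I_n) : piling := fun k =>
  if e i k then p k else behead (p k).
Definition top p x : bool := ohead (p x.1) == Some (Some x.2).
(** Right multiplication by a letter: it either cancels a letter that can be
    moved to the end, or is pushed. *)
Definition act p x : piling :=
  if top p (inv_letter x) then pop p x.1 else push p x.
Definition pile w : piling := foldl act (fun=> [::]) w.

Lemma pile_rcons w x : pile (rcons w x) = act (pile w) x.
Proof. by rewrite /pile -cats1 foldl_cat. Qed.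

Lemma pop_push p x : pop (push p x) x.1 = p.
Proof. by apply/funext => k; rewrite /pop /push; case: (e _ _). Qed.

Lemma top_push_same p x : top (push p x) x.
Proof. by rewrite /top /push e_irr eqxx. Qed.

Lemma top_push_adj p x y : e x.1 y.1 -> top (push p x) y = top p y.
Proof. by rewrite /top /push => ->. Qed.

Lemma top_push_nonadj p x y : ~~ e x.1 y.1 -> top (push p x) y = (x == y).
Proof.
case: x y => [i b] [j c] /=; rewrite /top /push /= => /negPf->.
by rewrite xpair_eqE [j == i]eq_sym /=; case: (i == j).
Qed.

Lemma pushC p x y : e x.1 y.1 -> push (push p x) y = push (push p y) x.
Proof.
move=> exy; apply/funext => k; rewrite /push.
case exk: (e x.1 k); case eyk: (e y.1 k) => //.
case: eqP exk => [->|_ _]; first by rewrite exy.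
by case: eqP eyk => [->|//]; rewrite e_sym exy.
Qed.

Inductive reduced : word n -> Prop :=
| reduced_nil : reduced [::]
| reduced_rcons w x : reduced w -> ~~ top (pile w) (inv_letter x) ->
    reduced (rcons w x).

Lemma pile_push w x :
  ~~ top (pile w) (inv_letter x) -> pile (rcons w x) = push (pile w) x.
Proof. by rewrite pile_rcons /act => /negPf->. Qed.

(** The last push at [x.1] is [x], and every later letter is adjacent to [x.1];
    deleting that occurrence commutes with the later pushes. *)
Lemma reduced_top w x : reduced w -> top (pile w) x ->
  exists s t, [/\ w = s ++ x :: t, all (fun y => e x.1 y.1) t,
    reduced (s ++ t), ~~ top (pile (s ++ t)) (inv_letter x) &
    pile w = push (pile (s ++ t)) x].
Proof.
elim=> {w} [|w y Rw IHw yP]; first by rewrite /top.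
rewrite pile_push //.
case eyx: (e y.1 x.1).
  rewrite top_push_adj // => /IHw[s [t [Ew xt Rst xst pE]]].
  have yst : ~~ top (pile (s ++ t)) (inv_letter y).
    by rewrite pE top_push_adj // e_sym in yP.
  exists s, (rcons t y); rewrite -rcons_cat; split=> //.
  - by rewrite Ew rcons_cat.
  - by rewrite all_rcons e_sym eyx.
  - exact: reduced_rcons.
  - by rewrite pile_push // top_push_adj.
  - by rewrite pE pile_push // pushC // e_sym.
rewrite top_push_nonadj ?eyx // => /eqP <-.
by exists w, [::]; rewrite cats0 cats1.
Qed.

(** The identities for [act] hold only on pilings that arise from words; this
    presents each of them as the piling of a reduced word, to which
    [reduced_top] applies. *)
Lemma pile_reduced w : exists2 w', reduced w' & pile w' = pile w.
Proof.
elim/last_ind: w => [|w x [w' Rw' Ew]].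
  by exists [::] => //; apply: reduced_nil.
rewrite pile_rcons -Ew /act; case: ifPn => [|ntop].
  move=> /(reduced_top Rw')[s [t [_ _ Rst _ ->]]].
  by exists (s ++ t); rewrite ?pop_push.
by exists (rcons w' x); [apply: reduced_rcons | rewrite pile_push].
Qed.

Lemma act_push p x : act (push p x) (inv_letter x) = p.
Proof. by rewrite /act inv_letterK top_push_same pop_push. Qed.

Lemma act_inv w x : act (act (pile w) x) (inv_letter x) = pile w.
Proof.
have [w' Rw' <-] := pile_reduced w; rewrite {2}/act; case: ifPn => ntop.
  have [s [t [_ _ _ xst ->]]] := reduced_top Rw' ntop.
  by rewrite pop_push /act (negPf xst).
exact: act_push.
Qed.

Lemma act_push_comm w x y :
  reduced w -> e x.1 y.1 -> act (push (pile w) x) y = push (act (pile w) y) x.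
Proof.
move=> Rw exy; rewrite /act top_push_adj //; case: ifP => [|_].
  move=> /(reduced_top Rw)[s [t [_ _ _ _ ->]]].
  rewrite (@pop_push _ (inv_letter y)) pushC ?(@pop_push _ (inv_letter y)) //.
  by rewrite e_sym.
by rewrite pushC.
Qed.

Lemma actC w x y :
  e x.1 y.1 -> act (act (pile w) x) y = act (act (pile w) y) x.
Proof.
have [w' Rw' <-] := pile_reduced w.
(* If [x'] cancels, the piling is a push of the inverse of [x'] and the
   claim follows from [act_push_comm]; so does the claim when [y'] cancels,
   and when neither does, both sides are two pushes. *)
have cancel_case x' y' : e x'.1 y'.1 -> top (pile w') (inv_letter x') ->
    act (act (pile w') x') y' = act (act (pile w') y') x'.
  move=> exy /[dup] xtop /(reduced_top Rw')[s [t [_ _ Rst _ pE]]].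
  have -> : act (pile w') x' = pile (s ++ t).
    by rewrite /act xtop pE (@pop_push _ (inv_letter x')).
  by rewrite pE act_push_comm // -{2}[x']inv_letterK act_push.
move=> exy; case: (boolP (top (pile w') (inv_letter x))) => [|/negPf xtop].
  exact: cancel_case.
case: (boolP (top (pile w') (inv_letter y))) => [ytop|/negPf ytop].
  by rewrite (cancel_case y x) // e_sym.
have eyx : e y.1 x.1 by rewrite e_sym.
have Ex : act (pile w') x = push (pile w') x by rewrite /act xtop.
have Ey : act (pile w') y = push (pile w') y by rewrite /act ytop.
by rewrite Ex Ey !act_push_comm // Ex Ey pushC.
Qed.

(** The piling is an invariant of the group element, since [act] satisfies the
    defining relations. *)
Lemma pile_eq u w : raag_eq e u w -> pile u = pile w.
Proof.
elim=> {u w} // [u w t _ -> _ //|u w x|u w i j eij];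
  rewrite /pile !foldl_cat /=; congr (foldl _ _ w).
- exact: act_inv.
- exact: actC.
Qed.

Lemma word_val_comm x t :
  all (fun y => e x.1 y.1) t -> commute (val [:: x]) (val t).
Proof.
elim: t => [|y t IHt] /=; first by move=> _; rewrite word_val0; apply: commute1.
case/andP=> exy /IHt Ct; rewrite -[y :: t]cat1s word_val_cat; apply: commuteM Ct.
case: x y exy {IHt} => [i b] [j c] /= eij; rewrite !word_val_letter.
have ijC := gen_commute eij.
have jVC : commute (gen e i) (gen e j)^-1 := commuteV ijC.
by case: b; case: c => //; apply/commute_sym/commuteV/commute_sym.
Qed.

(** At the first cancellation, the cancelled pair [x^-1 t x] has [t] commuting
    with [x], so both letters can be deleted. *)
Lemma reduced_or_shorter w : reduced w \/
  exists w', [/\ size w' < size w, {subset w' <= w} & val w' = val w].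
Proof.
elim/last_ind: w => [|w x [Rw|[w' [szw ww' E]]]].
- by left; apply: reduced_nil.
- case: (boolP (top (pile w) (inv_letter x))) => [xtop|]; last first.
    by left; apply: reduced_rcons.
  have [s [t [-> xt _ _ _]]] := reduced_top Rw xtop; right.
  exists (s ++ t); split.
  + by rewrite size_rcons !size_cat /= addnS ltnW.
  + by move=> y; rewrite mem_rcons inE !mem_cat inE => /orP[]->; rewrite ?orbT.
  + rewrite -cats1 -catA cat_cons -cat1s !word_val_cat; congr (_ * _).
    rewrite mulgA (word_val_comm xt) -mulgA -[LHS]mulg1; congr (_ * _).
    rewrite -word_val_cat -{2}[x]inv_letterK.
    exact/esym/word_valP/(@raag_cancel _ _ [::] [::]).
- right; exists (rcons w' x); rewrite !size_rcons ltnS; split=> // [y|].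
    by rewrite !mem_rcons !inE => /orP[->//|/ww'->]; rewrite orbT.
  by rewrite -!cats1 !word_val_cat E.
Qed.

(** The structure of the elements equal to their own reverse. Take [w] and
    [rev w] reduced (otherwise shorten) and let [x] be the first letter of [w],
    hence the last one of [rev w]. As both words have the same piling, some
    occurrence of [x] in [w] can be moved to the end. If it is not the first
    letter, [w = x r x] in the group with [r] again equal to its reverse, and
    [x] goes into [u]. If it is the first letter, [x] commutes with all the
    others and goes into [c]. The predicate [P] carries this commutation
    through the induction. *)
Lemma symmetric_split w (P : pred (letter n)) :
    val (rev w) = val w -> all P w ->
  exists u c, [/\ all P u, all P c, pairwise (fun x y => e x.1 y.1) c &
    val w = val (u ++ c ++ rev u)].
Proof.
have [m] := ubnP (size w); elim: m w P => // m IHm w P szw wrev Pw.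
have shorter w' : size w' < size w -> {subset w' <= w} -> val w' = val w ->
    exists u c, [/\ all P u, all P c, pairwise (fun x y => e x.1 y.1) c &
      val w = val (u ++ c ++ rev u)].
  move=> szw' ww' E; rewrite -E; apply: IHm.
  - exact: leq_trans szw' _.
  - by rewrite (word_val_rev_eq E) wrev.
  - by apply/allP=> x /ww'; apply: (allP Pw).
case: (reduced_or_shorter w) => [Rw|[w' [? ? ?]]]; last exact: (shorter w').
case: (reduced_or_shorter (rev w)) => [Rrw|[w' [szw' ww' Ew']]]; last first.
  apply: (shorter w'); rewrite -?wrev //; first by rewrite -(size_rev w).
  by move=> x /ww'; rewrite mem_rev.
case: w => [|x w] in m IHm szw wrev Pw shorter Rw Rrw *.
  by exists [::], [::].
have xtop : top (pile (x :: w)) x.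
  have /word_valP/pile_eq <- := wrev.
  move: Rrw; rewrite rev_cons; move E : (rcons _ x) => r Rr.
  case: {r} Rr E => [|r y Rr ry]; first by case: (rev w).
  by case/rcons_inj=> _ ->; rewrite pile_push ?top_push_same.
have [s [t [Ew xt _ _ _]]] := reduced_top Rw xtop.
case: s Ew => [|a s] [].
  (* The occurrence of [x] that moves to the end is the first letter. *)
  move=> wt; rewrite -{t}wt in xt.
  have wC := word_val_comm xt.
  have wrev' : val (rev w) = val w.
    apply: (mulIg (val [:: x])).
    by rewrite -wC -!word_val_cat cats1 -rev_cons.
  case/andP: Pw => Px Pw.
  have [|u [c [Pu Pc cl Ew]]] := IHm w (fun y => e x.1 y.1 && P y) szw wrev'.
    by apply/allP => y yw; rewrite (allP xt) ?(allP Pw).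
  have [xu Pu'] : all (fun y => e x.1 y.1) u /\ all P u.
    by apply/andP; rewrite -all_predI.
  have [xc Pc'] : all (fun y => e x.1 y.1) c /\ all P c.
    by apply/andP; rewrite -all_predI.
  exists u, (x :: c); split=> //=; rewrite ?Px ?xc //.
  rewrite -cat1s word_val_cat Ew !word_val_cat -[x :: c ++ _]cat1s !word_val_cat.
  by rewrite !mulgA (word_val_comm xu).
(* Here [x :: w] is [x :: s ++ x :: t], and the core is [s ++ t]. *)
move=> _ wE.
have sE : val (s ++ x :: t) = val (s ++ t) * val [:: x].
  by rewrite !word_val_cat -cat1s word_val_cat (word_val_comm xt) mulgA.
have wE' : val (x :: w) = val [:: x] * val (s ++ t) * val [:: x].
  by rewrite -cat1s word_val_cat wE sE mulgA.
have strev : val (rev (s ++ t)) = val (s ++ t).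
  apply: (mulgI (val [:: x])); apply: (mulIg (val [:: x])).
  rewrite -wE' -[in RHS]wrev.
  have /word_val_rev_eq -> : val (x :: w) = val (x :: (s ++ t) ++ [:: x]).
    by rewrite wE' -!word_val_cat.
  by move: (s ++ t) => r; rewrite rev_cons rev_cat -cats1 !word_val_cat.
have [||u [c [Pu Pc cl Ew]]] := IHm (s ++ t) P _ strev.
- apply: (@leq_trans (size (x :: w))) szw.
  by rewrite /= wE !size_cat /= addnS ltnS leqnSn.
- by move: Pw; rewrite /= wE !all_cat /= => /andP[_ /and3P[-> _ ->]].
exists (x :: u), c; split=> //=; first by case/andP: Pw => ->.
by rewrite wE' Ew rev_cons -cats1 -!word_val_cat /= -!catA.
Qed.
End ReducedWords.

(** * Pure palindromic automorphisms as a kernel *)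

Section PurePalindromic.
Variables (n : nat) (e : rel 'I_n).
Hypotheses (e_sym : symmetric e) (e_irr : irreflexive e).
Local Notation A := (raag e).
Local Notation v := (gen e).
Local Notation val := (word_val e).

Lemma word_ab2_rev (w : word n) : word_ab2 (rev w) = word_ab2 w.
Proof. by apply/colP => i; rewrite !mxE count_rev. Qed.

(** The outer letters of a palindrome come in pairs. *)
Lemma word_ab2_mirror (u c : word n) :
  word_ab2 (u ++ c ++ rev u) = word_ab2 c.
Proof.
rewrite !word_ab2_cat word_ab2_rev GRing.addrCA.
have -> : (word_ab2 u + word_ab2 u = 0)%R.
  by apply/colP => i; rewrite !mxE F2_addrr.
by rewrite GRing.addr0.
Qed.

Lemma palindrome_middle (w : word n) x : palindrome w -> middle_letter w x ->
  exists u, w = u ++ [:: x] ++ rev u.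
Proof.
move=> pw [s [t [st Ew]]]; exists s; rewrite Ew /=; congr (_ ++ _ :: _).
move: pw; rewrite /palindrome Ew rev_cat rev_cons cat_rcons => /eqP.
rewrite eqseq_cat ?size_rev // => /andP[/eqP <- _].
by rewrite revK.
Qed.

Lemma word_ab2_letter (i : 'I_n) b :
  word_ab2 [:: (i, b)] = (delta_mx i ord0)%R.
Proof. by apply/colP=> k; rewrite !mxE /= addn0 eqxx andbT eq_sym. Qed.

Lemma pairwise_adj_uniq (c : word n) :
  pairwise (fun x y => e x.1 y.1) c -> uniq (map fst c).
Proof.
move=> cl; apply: (@pairwise_uniq _ e) => //.
by rewrite pairwise_map.
Qed.

(** The letters of [c] have distinct vertices, so its mod 2 image determines
    them; only the sign is free. *)
Lemma clique_word_ab2 (c : word n) i :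
    pairwise (fun x y => e x.1 y.1) c -> word_ab2 c = (delta_mx i ord0)%R ->
  exists b, c = [:: (i, b)].
Proof.
move=> cl cE.
have c_i k : (k \in map fst c) = (k == i).
  have /colP/(_ k) := cE; rewrite !mxE eqxx andbT.
  have -> : count (fun x : letter n => x.1 == k) c = (k \in map fst c).
    by rewrite -count_uniq_mem ?pairwise_adj_uniq // count_map.
  by case: (_ \in _); case: eqP.
case: c cl {cE} c_i => [_ /(_ i)|[j b] [|[k d] c]] /=; first by rewrite eqxx.
  by move=> _ /(_ i); rewrite inE eqxx => /eqP ->; exists b.
case/andP => /andP[ejk _] _ c_i.
have := c_i j; have := c_i k; rewrite !inE !eqxx /= orbT.
by move=> /esym/eqP Ek /esym/eqP Ej; rewrite Ek Ej e_irr in ejk.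
Qed.

(** In [u c (rev u)] the mod 2 image forces [c] to be a single letter, which
    makes the word itself a palindrome with the required middle letter. *)
Lemma symmetric_palindrome (g : A) i :
    raag_iota e g = g^-1 -> ab2 g = (delta_mx i ord0)%R ->
  exists w : word n, [/\ palindrome w, exists b, middle_letter w (i, b) &
                         val w = g].
Proof.
elim/raagW: g => w /iota_inv_rev wrev; rewrite ab2E => wE.
have [u [c [_ _ cl Ew]]] :=
  @symmetric_split n e e_sym e_irr w xpredT wrev (all_predT _).
have [b cE] : exists b, c = [:: (i, b)].
  apply: clique_word_ab2 => //.
  by rewrite -wE -(ab2E e w) Ew ab2E word_ab2_mirror.
exists (u ++ c ++ rev u); split=> //.
  by rewrite /palindrome !rev_cat revK cE catA.
by exists b, u, (rev u); rewrite size_rev cE.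
Qed.

Lemma Phi2_kernelP (f : gaut A) :
  hom_kernel (@Phi2 n e) f <-> forall i, ab2 (f (v i)) = (delta_mx i ord0)%R.
Proof.
split=> [fE i | fE].
  have E : Phi2_mx f = (1%:M)%R := congr1 (@GL2_val n) fE.
  by rewrite Phi2_mxP E mul1mx ab2_gen.
apply: val_inj; apply/matrixP => i j.
by rewrite [LHS]mxE fE !mxE eqxx andbT.
Qed.

Lemma PPiA_kernel :
  PPiA e = (centraliser_of (raag_iota e) `&` hom_kernel (@Phi2 n e))%classic.
Proof.
apply/seteqP; split=> f.
  move=> pf; split.
    apply/centraliser_iotaP => i; have [w [pw _ <-]] := pf i.
    by apply/iota_inv_rev; rewrite pw.
  apply/Phi2_kernelP => i; have [w [pw [b mw] <-]] := pf i.
  have [u ->] := palindrome_middle pw mw.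
  by rewrite ab2E word_ab2_mirror word_ab2_letter.
case=> /centraliser_iotaP Cf /Phi2_kernelP kf i.
exact: symmetric_palindrome.
Qed.

Lemma PPiA_subgroup : is_subgroup (PPiA e).
Proof.
have [C1 CM] := centraliser_of_subgroup (raag_iota e).
rewrite PPiA_kernel; split=> [|f h [Cf kf] [Ch kh]]; split=> //=.
- exact: gmulf1.
- exact: CM.
- have E : Phi2 (f * h^-1) = Phi2 f * (Phi2 h)^-1 by rewrite gmulfM gmulfV.
  by apply: (etrans E); rewrite kf kh; apply: mulgV.
Qed.

End PurePalindromic.

(** * Ordered pairs of letters modulo 2 *)

Section OrderedPairs.
Local Open Scope ring_scope.
Variables (n : nat) (e : rel 'I_n).
Hypothesis e_sym : symmetric e.
Local Notation A := (raag e).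
Implicit Types (u w : word n) (a b : 'I_n).

(** For non-adjacent distinct [a] and [b], this is the corner entry of the image
    of the word in the group of unitriangular matrices of size 3 over the field
    with two elements, where [a] and [b] go to the two elementary generators
    and the other vertices to 1. Signs are invisible, as both generators
    are involutions. *)
Fixpoint pair_count a b w : 'F_2 :=
  if w is x :: w' then (x.1 == a)%:R * word_ab2 w' b ord0 + pair_count a b w'
  else 0.

Lemma word_ab2_cons x w a :
  word_ab2 (x :: w) a ord0 = (x.1 == a)%:R + word_ab2 w a ord0.
Proof. by rewrite !mxE /= GRing.natrD. Qed.

Lemma word_ab2_nil a : word_ab2 [::] a ord0 = 0.
Proof. by rewrite mxE. Qed.

Lemma word_ab2_catE u w a :
  word_ab2 (u ++ w) a ord0 = word_ab2 u a ord0 + word_ab2 w a ord0.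
Proof. by rewrite word_ab2_cat mxE. Qed.

Lemma pair_count_cat a b u w :
  pair_count a b (u ++ w) =
  pair_count a b u + pair_count a b w + word_ab2 u a ord0 * word_ab2 w b ord0.
Proof.
elim: u => [|x u IHu]; first by rewrite /= word_ab2_nil; ring.
by rewrite cat_cons /= IHu word_ab2_catE word_ab2_cons; ring.
Qed.

Lemma indicator_mul0 (k a b : 'I_n) :
  a != b -> (k == a)%:R * (k == b)%:R = 0 :> 'F_2.
Proof.
by move=> ab; case: eqP => [->|_]; rewrite ?(negPf ab) (GRing.mulr0, GRing.mul0r).
Qed.

Lemma pair_count_eq a b u w : a != b -> ~~ e a b ->
  raag_eq e u w -> pair_count a b u = pair_count a b w.
Proof.
move=> ab nab; elim=> {u w} // [u w t _ -> _ //|u w x|u w i j eij].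
  rewrite !pair_count_cat /= !word_ab2_cons ?word_ab2_nil /=.
  have ch2 : (2 \in [pchar 'F_2])%R := pchar_Fp (isT : prime 2).
  rewrite !(GRing.addr0, GRing.mulr0) indicator_mul0 // GRing.addrr_pchar2 //.
  by rewrite GRing.addKr_pchar2 //; ring.
rewrite !pair_count_cat /= !word_ab2_cons ?word_ab2_nil /=.
have E k l : e k l -> ((k == a)%:R * (l == b)%:R = 0 :> 'F_2)%R.
  move=> ekl; case: eqP ekl => [->|_]; rewrite ?GRing.mul0r //.
  by case: eqP => [->|_]; rewrite ?(negPf nab) ?GRing.mulr0.
have eji : e j i by rewrite e_sym.
by rewrite !(GRing.addr0, GRing.mulr0) !E //; ring.
Qed.

Lemma pair_count_rev a b w : pair_count a b (rev w) = pair_count b a w.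
Proof.
elim: w => [|x w IHw] //; rewrite rev_cons -cats1 pair_count_cat IHw /=.
by rewrite word_ab2_rev word_ab2_cons word_ab2_nil; ring.
Qed.

Lemma pair_count_sum a b w : a != b ->
  pair_count a b w + pair_count b a w = word_ab2 w a ord0 * word_ab2 w b ord0.
Proof.
move=> ab; elim: w => [|x w IHw] /=; first by rewrite word_ab2_nil; ring.
by rewrite GRing.addrACA IHw !word_ab2_cons; ring: (indicator_mul0 x.1 ab).
Qed.

(** The corner entries of [g h] and [h g] differ by the two sides. *)
Lemma ab2_commute (g h : A) a b : a != b -> ~~ e a b -> commute g h ->
  ab2 g a ord0 * ab2 h b ord0 = ab2 h a ord0 * ab2 g b ord0.
Proof.
move=> ab nab; elim/raagW: g => u; elim/raagW: h => w.
rewrite /commute -!word_val_cat => /word_valP/(pair_count_eq ab nab).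
rewrite !pair_count_cat !ab2E => E.
apply: (GRing.addrI (pair_count a b u + pair_count a b w)).
by rewrite E; ring.
Qed.

(** For an element equal to its reverse, the numbers of pairs [a .. b] and
    [b .. a] agree modulo 2, while their sum is the product of the numbers of
    [a] and of [b]. Hence the support of its mod 2 image is a clique. *)
Lemma ab2_symmetric (g : A) a b : a != b -> ~~ e a b ->
  raag_iota e g = (g^-1)%g -> ab2 g a ord0 * ab2 g b ord0 = 0.
Proof.
move=> ab nab; elim/raagW: g => w /iota_inv_rev.
move=> /word_valP/(pair_count_eq ab nab); rewrite pair_count_rev ab2E => E.
by rewrite -pair_count_sum // E F2_addrr.
Qed.

End OrderedPairs.

(** * Subgroups *)

Section Subgroups.
Variable G : groupType.
Implicit Types (H S : set G) (x y : G).

Lemma is_subgroupV H x : is_subgroup H -> H x -> H x^-1.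
Proof. by case=> H1 HM Hx; rewrite -[x^-1]mul1g; apply: HM. Qed.

Lemma is_subgroupM H x y : is_subgroup H -> H x -> H y -> H (x * y).
Proof.
by move=> Hg Hx Hy; rewrite -[y]invgK; apply: Hg.2 => //; apply: is_subgroupV.
Qed.

Lemma is_subgroup_cancel H x y : is_subgroup H -> H x -> H (x * y) -> H y.
Proof.
move=> Hg Hx Hxy; rewrite -[y](mulKg x).
by apply: is_subgroupM => //; apply: is_subgroupV.
Qed.

Lemma generated_is_subgroup S : is_subgroup (subgroup_generated_by S).
Proof.
split=> [H [[H1 _] _] // | x y Sx Sy H [Hg HS]].
by apply: Hg.2; [apply: Sx | apply: Sy].
Qed.

Lemma image_is_subgroup (L : groupType) (f : G -> L) H :
    {morph f : x y / x * y} -> is_subgroup H ->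
  is_subgroup (f @` H)%classic.
Proof.
move=> fM [H1 HM]; split; first by exists 1 => //; apply: morph_one.
move=> _ _ [x Hx <-] [y Hy <-]; exists (x * y^-1); first exact: HM.
by rewrite fM morph_inv.
Qed.

End Subgroups.

(** * Gaussian elimination along a preorder over the field with two elements *)

Section Elimination.
Local Open Scope ring_scope.
Variable n : nat.

Lemma F2_neq0 (x : 'F_2) : x != 0 -> x = 1.
Proof. by case: x => [[|[|k]] lt_k2] //= _; apply: val_inj. Qed.

Lemma elementary_unit (a i : 'I_n) :
  a != i -> (1%:M + delta_mx a i : 'M['F_2]_n) \in unitmx.
Proof.
move=> ai.
have : (1%:M + delta_mx a i) *m (1%:M + delta_mx a i) = 1%:M :> 'M['F_2]_n.
  rewrite mulmxDl !mulmxDr !mul1mx mulmx1 mul_delta_mx_0 1?eq_sym // GRing.addr0.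
  rewrite -GRing.addrA (_ : delta_mx a i + delta_mx a i = 0) ?GRing.addr0 //.
  by apply/matrixP => k l; rewrite !mxE F2_addrr.
by case/mulmx1_unit.
Qed.

Definition elementary (a i : 'I_n) (ai : a != i) : GL2 n :=
  MkGL2 (elementary_unit ai).

Lemma elementary_mulE (a i : 'I_n) (ai : a != i) (B : GL2 n) k l :
  (elementary ai * B)%g k l = B k l + (k == a)%:R * B i l.
Proof.
rewrite /= mulmxDl mul1mx mxE; congr (_ + _); rewrite mxE (bigD1 i) //= big1.
  by rewrite mxE eqxx andbT GRing.addr0.
by move=> j /negPf ji; rewrite mxE ji andbF GRing.mul0r.
Qed.

Section Preorder.
Variables (r : rel 'I_n) (H : set (GL2 n)).
Hypotheses (r_refl : reflexive r) (r_trans : transitive r).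
Hypothesis H_sub : is_subgroup H.
Hypothesis H_elem : forall a i (ai : a != i), r i a -> H (elementary ai).

(** The invertible elements of the incidence algebra of the preorder [r]. *)
Definition incidence (B : GL2 n) : Prop := forall a i, B a i != 0 -> r i a.
Definition unit_column (B : GL2 n) (d : 'I_n) : Prop :=
  forall k, B k d = (k == d)%:R.

Lemma elementary_stable (D : {set 'I_n}) (B : GL2 n) a i (ai : a != i) :
    r i a -> i \notin D -> incidence B -> {in D, forall d, unit_column B d} ->
  incidence (elementary ai * B)%g /\
  {in D, forall d, unit_column (elementary ai * B)%g d}.
Proof.
move=> ria iD incB colB; split=> [k l | d dD k]; rewrite elementary_mulE.
  case: (k =P a) => [->|_]; last by rewrite GRing.mul0r GRing.addr0; apply: incB.
  case: (eqVneq (B i l) 0) => [->|/incB rli _]; last exact: r_trans ria.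
  by rewrite GRing.mulr0 GRing.addr0; apply: incB.
rewrite !colB // (_ : (i == d) = false) ?GRing.mulr0 ?GRing.addr0 //.
by apply: contraNF iD => /eqP ->.
Qed.

(** If column [i] were supported in [D], then [B] would fix it, and it would be
    the basis vector [i] because [B] is invertible. *)
Lemma column_outside (D : {set 'I_n}) (B : GL2 n) i : i \notin D ->
    {in D, forall d, unit_column B d} -> exists2 a, a \notin D & B a i != 0.
Proof.
move=> iD colB; apply/exists_inP; apply: contraNT iD => /exists_inPn outD.
have Bfix : B *m col i B = col i B.
  apply/colP => k; rewrite !mxE (bigD1 k) //= big1 ?GRing.addr0.
    rewrite mxE; case: (boolP (k \in D)) => [/colB->|/outD].
      by rewrite eqxx GRing.mul1r.
    by rewrite negbK => /eqP ->; rewrite GRing.mulr0.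
  move=> j jk; rewrite mxE; case: (boolP (j \in D)) => [/colB->|/outD].
    by rewrite eq_sym (negPf jk) GRing.mul0r.
  by rewrite negbK => /eqP ->; rewrite GRing.mulr0.
have colE : col i B = delta_mx i ord0.
  rewrite -[LHS](mulKmx (GL2_unit B)) Bfix.
  by rewrite colE mulKmx ?GL2_unit.
apply: contraT => /outD; have /colP/(_ i) := colE; rewrite !mxE !eqxx => ->.
by [].
Qed.

(** With a pivot on the diagonal, each other nonzero entry [b] of column [i] is
    removed by adding row [i] to row [b]. This is allowed, as that entry
    itself gives [r i b], and row [i] vanishes on the finished columns. *)
Lemma clear_column (D : {set 'I_n}) (B : GL2 n) i :
    (forall B', incidence B' -> {in i |: D, forall d, unit_column B' d} ->
      H B') ->
    i \notin D -> incidence B -> {in D, forall d, unit_column B d} ->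
  B i i = 1 -> H B.
Proof.
move=> next iD.
have [m] := ubnP #|[set b | (b != i) && (B b i != 0)]|.
elim: m B => // m IHm B szB incB colB Bii.
case: (set_0Vmem [set b | (b != i) && (B b i != 0)]) => [B0|[b]].
  apply: next => // d; rewrite !inE => /orP[/eqP->|/colB//] k.
  have /setP/(_ k) := B0; rewrite !inE.
  by case: eqP => [->|_ /negbFE/eqP].
rewrite inE => /andP[bi Bbi].
have rib : r i b := incB _ _ Bbi.
have [incB' colB'] := elementary_stable bi rib iD incB colB.
apply: (is_subgroup_cancel H_sub (H_elem bi rib)).
apply: IHm => //; last first.
  by rewrite elementary_mulE eq_sym (negPf bi) GRing.mul0r GRing.addr0.
rewrite -ltnS; apply: leq_ltn_trans szB; apply: proper_card; apply/properP; split.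
  apply/fintype.subsetP => k; rewrite !inE elementary_mulE => /andP[-> /=].
  by case: (k =P b) => [-> //|_]; rewrite GRing.mul0r GRing.addr0.
exists b; rewrite !inE ?bi // elementary_mulE eqxx Bii (F2_neq0 Bbi) GRing.mul1r.
by rewrite F2_addrr eqxx.
Qed.

(** The columns in [D] are those already reduced to basis vectors. The next
    column [i] is taken with as few elements above it as possible, so that any
    [a] outside [D] above [i] is also below [i]. If the diagonal entry is zero,
    a row [a] as in [column_outside] can therefore be added to row [i] to make
    a pivot. *)
Lemma incidence_generated (B : GL2 n) : incidence B -> H B.
Proof.
suff gen m (D : {set 'I_n}) B' : (#|~: D| < m)%N -> incidence B' ->
    {in D, forall d, unit_column B' d} -> H B'.
  move=> incB; apply: (gen _ finset.set0 B (ltnSn _)) => // d.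
  by rewrite inE.
elim: m D B' => // m IHm D B' szD incB colB.
case: (set_0Vmem (~: D)) => [D0|[i0 i0D]].
  rewrite (_ : B' = 1%g); first exact: H_sub.1.
  apply: val_inj; apply/matrixP => k l; rewrite colB ?mxE //.
  by have /setP/(_ l) := D0; rewrite !inE => /negbFE.
case: (arg_minnP (fun i => #|r i|) i0D) => i iD' imin.
have {iD'} iD : i \notin D by move: iD'; rewrite -finset.in_setC.
have next B'' :
    incidence B'' -> {in i |: D, forall d, unit_column B'' d} -> H B''.
  apply: IHm; rewrite -ltnS; apply: leq_ltn_trans szD.
  apply: proper_card; apply/properP; split.
    by rewrite finset.setCS finset.subsetUr.
  by exists i; rewrite !inE ?eqxx.
have [Bii|/F2_neq0 Bii] := eqVneq (B' i i) 0; last first.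
  exact: (clear_column next iD incB colB Bii).
have [a aD Bai] := column_outside iD colB.
have ia : i != a by apply: contraNneq Bai => <-; rewrite Bii.
have rai : r a i.
  have ria := incB _ _ Bai.
  have up : r a \subset r i by apply/fintype.subsetP => b; apply: r_trans.
  have cardE : #|r a| = #|r i|.
    have aDc : a \in ~: D by rewrite finset.in_setC.
    by apply/eqP; rewrite eqn_leq subset_leq_card // (imin _ aDc).
  by have /(subset_cardP cardE)/(_ i) := up; rewrite !unfold_in r_refl.
have [incB' colB'] := elementary_stable ia rai aD incB colB.
apply: (is_subgroup_cancel H_sub (H_elem ia rai)).
apply: (clear_column next iD incB' colB').
by rewrite elementary_mulE eqxx Bii GRing.mul1r GRing.add0r (F2_neq0 Bai).
Qed.

End Preorder.

(** Some term of the Leibniz expansion of the determinant is nonzero. *)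
Lemma nonzero_transversal (B : GL2 n) :
  exists s : {perm 'I_n}, forall j, B (s j) j != 0.
Proof.
have : \det (B : 'M_n) != 0 by rewrite -GRing.unitfE -unitmxE GL2_unit.
rewrite -det_tr; apply: contraNP => /forallNP none; apply/eqP.
apply: big1 => s _; have /existsNP[j /negP] := none s; rewrite negbK => /eqP Bj.
by rewrite (bigD1 j) //= mxE Bj GRing.mul0r GRing.mulr0.
Qed.

End Elimination.

(** * The image of the centraliser *)

(** The inverse of a permutation of a finite set is one of its powers. *)
Lemma perm_graph_automorphism (T : finType) (e : rel T) (s : {perm T}) :
  (forall i j, e i j -> e (s i) (s j)) -> forall i j, e (s i) (s j) = e i j.
Proof.
move=> es i j; apply/idP/idP; last exact: es.
have esX k x y : e x y -> e ((s ^+ k) x) ((s ^+ k) y).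
  elim: k => [|k IHk] exy; first by rewrite expg0 !perm1.
  by rewrite expgSr !permM es ?IHk.
have sK x : (s ^+ #[s].-1) (s x) = x.
  by rewrite -permM -expgS prednK ?order_gt0 // expg_order perm1.
by move/(esX #[s].-1); rewrite !sK.
Qed.

Section Image.
Variables (n : nat) (e : rel 'I_n).
Hypotheses (e_sym : symmetric e) (e_irr : irreflexive e).
Local Notation A := (raag e).
Local Notation v := (gen e).

Lemma in_st a b : (b \in st e a) = (b == a) || e a b.
Proof. by rewrite !inE orbC. Qed.

(** For [j = i] this says that the support of the mod 2 image of [f (v i)] is a
    clique. For [j] adjacent to [i], if [b] were outside the star of [a], then
    [ab2_commute] would put [b] in the support for [i] too, against the clique
    property. *)
Lemma support_in_star (f : gaut A) i j a b :
    centraliser_of (raag_iota e) f -> j \in st e i ->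
    Phi2_mx f a i != 0%R -> Phi2_mx f b j != 0%R ->
  b \in st e a.
Proof.
move=> /centraliser_iotaP Cf; rewrite in_st => ij.
have Mnz (x y : 'F_2) : (x != 0 -> y != 0 -> x * y != 0)%R.
  by move=> /F2_neq0 -> /F2_neq0 ->.
rewrite ![Phi2_mx f _ _]mxE => Mai Mbj; rewrite in_st.
apply: contraT; rewrite negb_or eq_sym => /andP[ab nab].
have clique k :
    ab2 (f (v k)) a ord0 != 0%R -> ab2 (f (v k)) b ord0 != 0%R -> False.
  by move=> ka kb; have := Mnz _ _ ka kb; rewrite ab2_symmetric ?eqxx.
case/orP: ij => [/eqP ji|eij]; first by rewrite ji in Mbj; case: (clique i Mai Mbj).
have fC : commute (f (v i)) (f (v j)).
  by rewrite /commute -!gautM gen_commute.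
have := Mnz _ _ Mai Mbj; rewrite (ab2_commute e_sym ab nab fC) => nz.
have Mbi : ab2 (f (v i)) b ord0 != 0%R.
  by apply: contraNneq nz => ->; rewrite GRing.mulr0.
by case: (clique i Mai Mbi).
Qed.

Lemma diagram_aut_centralises f :
  diagram_aut e f -> centraliser_of (raag_iota e) f.
Proof.
by case=> s [_ fE]; apply/centraliser_iotaP => i; rewrite fE raag_iota_gen.
Qed.

Lemma transvection_centralises f :
  adjacent_dominated_transvection e f -> centraliser_of (raag_iota e) f.
Proof.
case=> i [j [_ _ /eqP/commgP ijC [fi fE]]]; apply/centraliser_iotaP => k.
have [->|/fE->] := eqVneq k i; last by rewrite raag_iota_gen.
by rewrite fi gautM !raag_iota_gen ijC invgM.
Qed.

Lemma Phi2_transvection (f : gaut A) i j :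
  is_transvection i j f -> Phi2_mx f = (1%:M + delta_mx j i)%R.
Proof.
case=> fi fE; apply/matrixP => k l; rewrite [LHS]mxE [RHS]mxE.
have [->|li] := eqVneq l i; first by rewrite fi ab2M !ab2_gen !mxE !eqxx !andbT.
by rewrite fE // ab2_gen !mxE (negPf li) eqxx andbT andbF GRing.addr0.
Qed.

Let generated := subgroup_generated_by (@Phi2 n e @`
  (diagram_aut e `|` adjacent_dominated_transvection e))%classic.

Lemma elementary_generated a i (ai : a != i) :
  st e i \subset st e a -> generated (elementary ai).
Proof.
move=> sub_st; have eai : e a i.
  have := fintype.subsetP sub_st i; rewrite !in_st eqxx /= => /(_ isT).
  by rewrite eq_sym (negPf ai).
have via : vle e i a.
  by apply: fintype.subset_trans sub_st; apply: finset.subsetUl.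
have eia : e i a by rewrite e_sym.
have [f ft] := transvection_exists e_irr e_sym eia via.
apply: sub_gen_smallest; exists f.
  right; exists i, a; split=> //; first by rewrite eq_sym.
  exact: gen_comm.
exact/val_inj/Phi2_transvection.
Qed.

(** A nonzero transversal [s] of the matrix of [f] is a graph automorphism by
    [support_in_star]. Dividing by it gives a matrix whose entry at [(a, i)]
    can be nonzero only if the star of [a] contains that of [i]: for [x] in
    the star of [i], [s x] lies in the star of [s a]. Elimination along the
    inclusion of stars then writes it as a product of transvections. *)
Lemma Phi2_centraliser_generated (f : gaut A) :
  centraliser_of (raag_iota e) f -> generated (Phi2 f).
Proof.
move=> Cf; have [s sP] := nonzero_transversal (Phi2 f).
have es : forall i j, e (s i) (s j) = e i j.
  apply: perm_graph_automorphism => i j eij.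
  have := @support_in_star f i j (s i) (s j) Cf.
  rewrite !in_st eij orbT => /(_ isT (sP i) (sP j)) /orP[/eqP/perm_inj ij|//].
  by rewrite ij e_irr in eij.
have [d dE] := diagram_aut_exists es.
have dgen : generated (Phi2 d).
  by apply: sub_gen_smallest; exists d => //; left; exists s.
have fE : Phi2 f = Phi2 d * Phi2 (d^-1 * f) by rewrite -gmulfM mulKVg.
rewrite fE; apply: (is_subgroupM (generated_is_subgroup _) dgen).
have shift a i : Phi2 f (s a) i = Phi2 (d^-1 * f) a i.
  rewrite fE /= mxE (bigD1 a) //= big1 => [|k ka].
    by rewrite [Phi2_mx d _ _]mxE dE ab2_gen mxE !eqxx GRing.mul1r GRing.addr0.
  rewrite [Phi2_mx d _ _]mxE dE ab2_gen mxE (inj_eq perm_inj) eq_sym (negPf ka).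
  by rewrite GRing.mul0r.
apply: (@incidence_generated _ (fun i a => st e i \subset st e a)).
- by move=> i; apply: fintype.subxx.
- by move=> j i k /= ij jk; apply: fintype.subset_trans ij jk.
- exact: generated_is_subgroup.
- exact: elementary_generated.
move=> a i; rewrite -shift => Mai; apply/fintype.subsetP => x xi.
have := support_in_star Cf xi Mai (sP x).
by rewrite !in_st es (inj_eq perm_inj).
Qed.

End Image.

Local Open Scope classical_set_scope.

Theorem theorem3p3 (n : nat) (e : rel 'I_n)
    (e_sym : symmetric e) (e_irr : irreflexive e) :
  [/\ is_subgroup (PPiA e),
      PPiA e `<=` centraliser_of (raag_iota e),
      PPiA e = centraliser_of (raag_iota e) `&` hom_kernel (@Phi2 n e) &
      @Phi2 n e @` centraliser_of (raag_iota e) =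
        subgroup_generated_by (@Phi2 n e @`
          (diagram_aut e `|` adjacent_dominated_transvection e))].
Proof.
split.
- exact: PPiA_subgroup.
- by rewrite (PPiA_kernel e_sym e_irr) => f [].
- exact: PPiA_kernel.
apply/seteqP; split.
  by move=> _ [f Cf <-]; apply: Phi2_centraliser_generated.
apply: smallest_sub.
  apply: image_is_subgroup (centraliser_of_subgroup _) => f h.
  exact: gmulfM.
apply: image_subset => f [].
  exact: diagram_aut_centralises.
exact: transvection_centralises.
Qed.
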